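(* Let $r\ge 2$ and $t\ge 1$ be integers. For any $r$-uniform tree $T$, $\chi(T,t)\le |E(T)|^t+1$.
   Context: Hypergraphs $H=(V,E)$ are finite: $V$ is a nonempty finite set of vertices and $E$ is a set of subsets of $V$ (edges), each of size at least $2$; $H$ is $r$-uniform if all edges have size $r$. The edge set of a hypergraph being colored is allowed to be empty. A $k$-coloring $c:V\to\{1,\dots,k\}$ is proper if no edge is monochromatic; the chromatic number $\chi(H)$ is the least $m\ge 1$ such that $H$ has a proper $m$-coloring, and then $H$ is called $m$-chromatic. A cycle is a sequence of $k\ge 2$ distinct vertices $v_1,\dots,v_k$ and $k$ distinct edges $e_1,\dots,e_k$ with $v_i,v_{i+1}\in e_i$ (indices mod $k$); in particular two edges meeting in at least two vertices form a $2$-cycle. A hypergraph is acyclic if it contains no cycles, and a tree is a connected acyclic hypergraph (connected: for every partition of the vertex set into two nonempty parts some edge meets both parts). A $t$-edge-coloring of $H=(V,E)$ is a partition $E=E_1\cup\dots\cup E_t$ into $t$ pairwise disjoint (possibly empty) color classes. A monochromatic copy of $T$ is a (not necessarily induced) subhypergraph isomorphic to $T$ all of whose edges lie in one class $E_i$. For an acyclic $r$-uniform hypergraph $T$, the ($t$-color) chromatic Ramsey number $\chi(T,t)$ is the smallest positive integer $m$ such that under any $t$-edge-coloring of any $m$-chromatic $r$-uniform hypergraph there is a monochromatic copy of $T$. An upper bound on $\chi(T,t)$ includes the assertion that such an $m$ exists. *)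

(* Defs.v *)
From mathcomp Require Import all_boot.
Set Implicit Arguments.
Unset Strict Implicit.
Unset Printing Implicit Defensive.

Record hypergraph := Hypergraph {
  vertex : finType;
  edges : {set {set vertex}};
  vertex_gt0 : 0 < #|vertex|;
  edge_gt1 : forall e, e \in edges -> 1 < #|e|
}.

Definition uniform (r : nat) (H : hypergraph) : Prop :=
  forall e, e \in edges H -> #|e| = r.

Definition proper_coloring (H : hypergraph) (k : nat)
    (c : {ffun vertex H -> 'I_k}) : bool :=
  [forall e in edges H, ~~ [forall x in e, forall y in e, c x == c y]].

Definition colorable (H : hypergraph) (k : nat) : bool :=
  [exists c : {ffun vertex H -> 'I_k}, proper_coloring c].

(* Colorings with pairwise distinct colors are proper, as edges have size at
   least 2. *)
Lemma colorable_ex (H : hypergraph) : exists k, (0 < k) && colorable H k.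
Proof.
exists #|vertex H|; rewrite vertex_gt0 /=.
apply/existsP; exists [ffun x => enum_rank x].
apply/forall_inP => e /edge_gt1 /card_gt1P [x [y [xe ye]]].
apply: contra => /forall_inP /(_ x xe) /forall_inP /(_ y ye).
by rewrite !ffunE => /eqP /enum_rank_inj ->.
Qed.

Definition chromatic_number (H : hypergraph) : nat := ex_minn (colorable_ex H).

(* [ordS i] is [i + 1] modulo [k]. *)
Definition is_cycle (H : hypergraph) (k : nat)
    (v : 'I_k -> vertex H) (e : 'I_k -> {set vertex H}) : Prop :=
  [/\ 2 <= k, injective v, injective e &
      forall i, [/\ e i \in edges H, v i \in e i & v (ordS i) \in e i]].

Definition acyclic (H : hypergraph) : Prop :=
  forall k (v : 'I_k -> vertex H) (e : 'I_k -> {set vertex H}),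
    ~ is_cycle v e.

Definition connected (H : hypergraph) : Prop :=
  forall A : {set vertex H}, A != set0 -> ~: A != set0 ->
    exists e, [/\ e \in edges H, e :&: A != set0 & e :&: ~: A != set0].

Definition is_tree (H : hypergraph) : Prop := connected H /\ acyclic H.

Definition edge_coloring (H : hypergraph) (t : nat)
    (P : 'I_t -> {set {set vertex H}}) : Prop :=
  \bigcup_i P i = edges H /\ forall i j, i != j -> [disjoint P i & P j].

(* The pair [(W, F)] of a vertex set and an edge set is a subhypergraph of
   [H], not necessarily induced. *)
Definition subhypergraph (H : hypergraph)
    (W : {set vertex H}) (F : {set {set vertex H}}) : Prop :=
  F \subset edges H /\ forall e, e \in F -> e \subset W.

Definition isomorphic_to_sub (T H : hypergraph)
    (W : {set vertex H}) (F : {set {set vertex H}}) : Prop :=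
  exists f : vertex T -> vertex H,
    [/\ injective f, [set f x | x : vertex T] = W &
        [set f @: e | e : {set vertex T} in edges T] = F].

Definition monochromatic_copy (T H : hypergraph) (t : nat)
    (P : 'I_t -> {set {set vertex H}}) : Prop :=
  exists (i : 'I_t) (W : {set vertex H}) (F : {set {set vertex H}}),
    [/\ subhypergraph W F, isomorphic_to_sub T W F & F \subset P i].

Definition ramsey_property (r : nat) (T : hypergraph) (t m : nat) : Prop :=
  forall H : hypergraph, uniform r H -> chromatic_number H = m ->
  forall P : 'I_t -> {set {set vertex H}}, edge_coloring P ->
    monochromatic_copy T P.

(* [m] is the t-color chromatic Ramsey number of [T] among r-uniform
   hypergraphs. The uniformity is a parameter since an edgeless [T] does not
   determine it; a relation is used since the minimum need not exist a priori. *)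
Definition is_chromatic_ramsey_number
    (r : nat) (T : hypergraph) (t m : nat) : Prop :=
  [/\ 0 < m, ramsey_property r T t m &
      forall n, 0 < n -> ramsey_property r T t n -> m <= n].

(* Main.v *)
Require Import Defs.
From mathcomp Require Import all_boot.
From Stdlib Require Import Classical_Prop.
Set Implicit Arguments.
Unset Strict Implicit.
Unset Printing Implicit Defensive.

(** Write [q] for the number of edges of [T].  Everything rests on the case of
    one color: a uniform hypergraph [H] that is not [q]-colorable contains [T]
    ([tree_embedding]).

    Color [H] properly with natural numbers so that the sum of the colors is
    minimal.  No vertex [x] can then be recolored with a color [j] below its
    own, so some edge through [x] has all its other vertices of color [j]
    ([greedy_coloring]).  Since [H] is not [q]-colorable, some vertex has a
    color at least [q]; it is the image of a root of [T].  Now [T] is built from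
    its root by adding edges one at a time, each meeting the part already built
    in a single vertex ([tree_ind]).  Use the colors [q - 1, ..., 0] in this
    order: the new edge is attached at a vertex whose image has a larger color
    than the current color [j], so that vertex lies on an edge of [H] whose
    other vertices all have color [j].  No vertex used before has color [j];
    hence the embedding stays injective, whatever edge of [H] is picked.

    For [t] colors, if no class contains [T], then every class has a proper
    [q]-coloring, and the product of these colorings is a proper coloring of the
    whole hypergraph with [q ^ t] colors ([colorable_product]). *)

(** * Building a tree edge by edge *)

Section Chains.
Variable V : finType.
Implicit Types (S : {set {set V}}) (e : {set V}) (a b : V * {set V}).

Definition link a b := b.1 \in a.2.

(** [a :: s] lists the vertices of a path from [x] to [y], each paired with the
    edge of [S] that leads from it to the next vertex, the last edge leading to
    [y].  In this form a path that is closed by one more edge through [x] and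
    [y] is literally a cycle. *)
Definition joined S (x y : V) :=
  exists a s, [/\ a.1 = x,
    all (fun b => (b.2 \in S) && (b.1 \in b.2)) (a :: s),
    path link a s /\ y \in (last a s).2,
    uniq [seq b.2 | b <- a :: s] &
    uniq (y :: [seq b.1 | b <- a :: s])].

Lemma joined_edge S e x y :
  e \in S -> x \in e -> y \in e -> x != y -> joined S x y.
Proof.
move=> eS xe ye xy; exists (x, e), [::].
by split; rewrite //= ?eS ?xe // inE eq_sym xy.
Qed.

Section AddEdge.
Variables (S : {set {set V}}) (U e : {set V}).
Hypothesis SU : forall d, d \in S -> d \subset U.
Hypothesis eS : e \notin S.

Lemma chain_fst s z :
  all (fun b => (b.2 \in S) && (b.1 \in b.2)) s ->
  z \notin U -> z \notin [seq b.1 | b <- s].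
Proof.
move=> /allP sS; apply: contra => /mapP[b /sS /andP[bS bb] ->].
exact: (subsetP (SU bS)).
Qed.

Lemma chain_snd s :
  all (fun b => (b.2 \in S) && (b.1 \in b.2)) s ->
  e \notin [seq b.2 | b <- s].
Proof.
by move=> /allP sS; apply: contra eS => /mapP[b /sS /andP[bS _] ->].
Qed.

Lemma chainW s :
  all (fun b => (b.2 \in S) && (b.1 \in b.2)) s ->
  all (fun b => (b.2 \in e |: S) && (b.1 \in b.2)) s.
Proof. by apply: sub_all => b /andP[bS ->]; rewrite setU1r. Qed.

Lemma joinedW x y : joined S x y -> joined (e |: S) x y.
Proof.
by move=> [a [s [ax sS pth ue uv]]]; exists a, s; split=> //; apply: chainW.
Qed.

(** Paths are extended at both ends, here and in [joined_cons]: this keeps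
    [joined] available in both directions without reversing a path. *)
Lemma joined_rcons x y z : x \in U -> joined S x y ->
  y \in e -> z \in e -> z \notin U -> y \in U -> joined (e |: S) x z.
Proof.
move=> xU [a [s [ax sS [pth ya] ue uv]]] ye ze zU yU.
exists a, (rcons s (y, e)); split=> //.
- by rewrite -rcons_cons all_rcons [X in X && _]/= setU11 ye; apply: chainW.
- by rewrite rcons_path pth last_rcons.
- by rewrite -rcons_cons map_rcons rcons_uniq chain_snd.
- rewrite -rcons_cons map_rcons cons_uniq mem_rcons inE negb_or.
  rewrite rcons_uniq -cons_uniq uv andbT chain_fst // andbT.
  by apply: contraNneq zU => ->.
Qed.

Lemma joined_cons x y z : joined S x y ->
  x \in e -> z \in e -> z \notin U -> y \in U -> joined (e |: S) z y.
Proof.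
move=> [a [s [ax sS [pth ya] ue uv]]] xe ze zU yU.
exists (z, e), (a :: s); split=> //.
- by rewrite -cat1s all_cat (chainW sS) /= setU11 ze.
- by split; rewrite //= /link /= ax xe.
- by rewrite map_cons cons_uniq ue andbT chain_snd.
- move: uv; rewrite cons_uniq => /andP[yv uv'].
  rewrite map_cons cons_uniq in_cons negb_or yv andbT cons_uniq uv' andbT.
  by rewrite (chain_fst sS zU) andbT /=; apply: contraNneq zU => <-.
Qed.

End AddEdge.
End Chains.

(** An edge through both ends of a path that does not use it closes a cycle. *)
Lemma acyclic_joined (T : hypergraph) (S : {set {set vertex T}}) e x y :
  acyclic T -> S \subset edges T -> e \in edges T -> e \notin S ->
  joined S x y -> x \in e -> y \in e -> False.
Proof.
move=> acT ST eT eS [a [s [ax sS [pth ya] ue uv]]] xe ye.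
pose p := rcons s (y, e); pose k := (size p).+1.
have szp : size (a :: p) = k by [].
have cyc : path (@link _) a (rcons p a).
  by rewrite !rcons_path pth last_rcons /link ya /= ax xe.
have pT b : b \in a :: p -> (b.2 \in edges T) && (b.1 \in b.2).
  rewrite -rcons_cons mem_rcons inE => /predU1P[-> | /(allP sS)].
    by rewrite /= eT ye.
  by case/andP=> bS ->; rewrite (subsetP ST).
have u1 : uniq [seq b.1 | b <- a :: p].
  by rewrite -rcons_cons map_rcons rcons_uniq -cons_uniq.
have u2 : uniq [seq b.2 | b <- a :: p].
  by rewrite -rcons_cons map_rcons rcons_uniq ue (chain_snd eS sS).
pose b (i : 'I_k) := nth a (a :: p) i.
apply: (acT k (fun i => (b i).1) (fun i => (b i).2)); split.
- by rewrite /k size_rcons.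
- move=> i j eq_ij; apply/val_inj/eqP.
  rewrite -(nth_uniq a.1 _ _ u1) ?size_map ?szp //= -!map_cons.
  by rewrite !(nth_map a) //; apply/eqP.
- move=> i j eq_ij; apply/val_inj/eqP.
  rewrite -(nth_uniq a.2 _ _ u2) ?size_map ?szp //= -!map_cons.
  by rewrite !(nth_map a) //; apply/eqP.
move=> i; have /pT/andP[-> ->] : b i \in a :: p by rewrite mem_nth.
split=> //; have := pathP a cyc i; rewrite size_rcons => /(_ (ltn_ord i)).
rewrite /link /= -rcons_cons (nth_rcons a (a :: p)) (nth_rcons a p) szp.
rewrite ltn_ord.
case: ltnP => [lti | gei].
  by rewrite /b [_ (ordS i)]/= modn_small ?ltnS.
have eqi : i = size p :> nat by apply/eqP; rewrite eqn_leq gei -ltnS ltn_ord.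
by rewrite eqi eqxx /b /= eqi modnn.
Qed.

(** A tree is obtained from any root by adding edges one at a time, each meeting
    the set of vertices already reached in a single vertex: connectedness gives
    an edge leaving that set, and acyclicity forbids a second common vertex,
    since any two reached vertices are joined by the edges already added.  For
    the same reason every edge has been added once all vertices are reached. *)
Lemma tree_ind (T : hypergraph) (x0 : vertex T)
    (Q : {set vertex T} -> {set {set vertex T}} -> Prop) :
  is_tree T -> Q [set x0] set0 ->
  (forall U S e x, Q U S -> e \in edges T -> e \notin S ->
     x \in e -> x \in U -> (forall y, y \in e -> y \in U -> y = x) ->
     Q (U :|: e) (e |: S)) ->
  Q setT (edges T).
Proof.
move=> [conT acT] Q0 Qstep.
pose inv U S := [/\ Q U S, x0 \in U, S \subset edges T,
  forall d, d \in S -> d \subset U &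
  forall x y, x \in U -> y \in U -> x != y -> joined S x y].
have meet1 U S e : inv U S -> e \in edges T -> e \notin S ->
    forall x y, x \in e -> x \in U -> y \in e -> y \in U -> y = x.
  move=> [_ _ ST _ joinU] eT eS x y xe xU ye yU; apply/eqP.
  apply: contraT => yx; exfalso.
  exact: (acyclic_joined acT ST eT eS (joinU _ _ yU xU yx)).
have inv0 : inv [set x0] set0.
  split; rewrite ?set11 ?sub0set //.
    by move=> d; rewrite inE.
  by move=> x y /set1P-> /set1P->; rewrite eqxx.
suff grow n U S : #|~: U| <= n -> inv U S -> Q setT (edges T).
  exact: grow (leqnn _) inv0.
elim: n U S => [|n IHn] U S leU invU; last first.
  have [UT | UnT] := eqVneq (~: U) set0.
    by apply: IHn invU; rewrite UT cards0.
  have [Q_US x0U ST SU joinU] := invU.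
  have Un0 : U != set0 by apply/set0Pn; exists x0.
  have [e [eT /set0Pn[x /setIP[xe xU]] /set0Pn[z /setIP[ze]]]] :=
    conT U Un0 UnT.
  rewrite inE => zU.
  have eS : e \notin S.
    by apply: contra zU => /SU /subsetP; apply.
  have ex := meet1 _ _ _ invU eT eS x.
  apply: (IHn (U :|: e) (e |: S)).
    rewrite -ltnS; apply: leq_trans leU; apply: proper_card.
    rewrite properC properUl //; apply/subsetPn; by exists z.
  split; first by apply: (Qstep U S e x) => // y ye yU; apply: ex.
  - by rewrite inE x0U.
  - by rewrite subUset sub1set eT.
  - move=> d; rewrite inE => /orP[/set1P-> | /SU dU]; first exact: subsetUr.
    by rewrite (subset_trans dU) ?subsetUl.
  move=> u w; rewrite !inE.
  have [uU _ | uU /= ue] := boolP (u \in U);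
    have [wU _ | wU /= we] := boolP (w \in U) => uw.
  - exact/joinedW/joinU.
  - have [ux | ux] := eqVneq u x.
      by apply: (@joined_edge _ _ e); rewrite ?setU11 // ux.
    exact: (joined_rcons SU eS uU (joinU _ _ uU xU ux)).
  - have [xw | xw] := eqVneq x w.
      by apply: (@joined_edge _ _ e); rewrite ?setU11 // -xw.
    exact: (joined_cons SU eS (joinU _ _ xU wU xw)).
  - by apply: (@joined_edge _ _ e); rewrite ?setU11.
have UT : U = setT.
  by apply: setC_inj; rewrite setCT; apply/eqP; rewrite -cards_eq0 -leqn0.
have [Q_US _ ST _ _] := invU; rewrite UT in Q_US invU.
suff <- : S = edges T by [].
apply/eqP; rewrite eqEsubset ST; apply/subsetP=> e eT; apply: contraT => eS.
have /card_gt1P[x [y [xe ye /eqP[]]]] := edge_gt1 eT.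
exact: (meet1 _ _ _ invU eT eS).
Qed.

(** * Greedy colorings and embeddings of trees *)

(** A proper coloring of minimal total color: recoloring [x] with a smaller
    color [j] must make some edge monochromatic. *)
Lemma greedy_coloring (H : hypergraph) :
  exists c : vertex H -> nat,
    (forall e, e \in edges H -> exists x y, [/\ x \in e, y \in e & c x != c y])
    /\ (forall x j, j < c x -> exists e,
          [/\ e \in edges H, x \in e & forall y, y \in e -> y != x -> c y = j]).
Proof.
have [k /andP[_ /existsP[c0 proper0]]] := colorable_ex H.
case: (arg_minnP (fun c : {ffun vertex H -> 'I_k} => \sum_x c x)
  proper0) => c /forall_inP properc minc.
exists (fun x => nat_of_ord (c x)); split=> [e /properc | x j ltj].
  rewrite negb_forall_in => /exists_inP[x xe].
  by rewrite negb_forall_in => /exists_inP[y ye cxy]; exists x, y.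
pose j' := Ordinal (ltn_trans ltj (ltn_ord (c x))).
pose c' := [ffun y => if y == x then j' else c y].
have : ~~ proper_coloring c'.
  apply/negP=> /minc; rewrite leqNgt => /negP; apply.
  rewrite (bigD1 x) //= [X in _ < X](bigD1 x) //= ffunE eqxx -addSn.
  by rewrite leq_add //; apply: leq_sum => y /negPf yx; rewrite ffunE yx.
rewrite negb_forall_in => /exists_inP[e eH]; rewrite negbK => /forall_inP mono.
have mono' y z : y \in e -> z \in e -> c' y = c' z.
  by move=> ye ze; apply/eqP; apply: (forall_inP (mono y ye)).
have xe : x \in e.
  apply: contraT => xe; case/negP: (properc e eH).
  have nx w : w \in e -> (w == x) = false.
    by move=> we; apply: contraNF xe => /eqP<-.
  apply/forall_inP=> y ye; apply/forall_inP=> z ze.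
  by have := mono' y z ye ze; rewrite !ffunE !nx // => ->.
exists e; split=> // y ye /negPf yx.
by have := mono' y x ye xe; rewrite !ffunE yx eqxx => ->.
Qed.

Lemma eq_card_bij (A B : finType) (X : {set A}) (Y : {set B}) :
  #|X| = #|Y| -> 0 < #|X| ->
  exists g : A -> B, g @: X = Y /\ {in X &, injective g}.
Proof.
move=> eqXY X0; have /card_gt0P[y0 _] : 0 < #|Y| by rewrite -eqXY.
pose g u := nth y0 (enum Y) (index u (enum X)).
have idx u : u \in X -> index u (enum X) < size (enum Y).
  by move=> uX; rewrite -cardE -eqXY cardE index_mem mem_enum.
have gI : {in X &, injective g}.
  move=> u w uX wX /eqP; rewrite nth_uniq ?enum_uniq ?idx // => /eqP.
  by apply: (index_inj u); rewrite mem_enum.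
exists g; split=> //; apply/eqP; rewrite eqEcard card_in_imset // eqXY leqnn.
rewrite andbT; apply/subsetP=> _ /imsetP[u uX ->].
by rewrite -mem_enum mem_nth ?idx.
Qed.

(** During the construction of [T], with edges [S] added so far, the images of
    the reached vertices have colors at least [q - #|S|]; the next edge is sent
    to an edge whose new vertices have color exactly [q - #|S| - 1]. *)
Lemma tree_embedding (r : nat) (T H : hypergraph) :
  uniform r T -> is_tree T -> uniform r H -> ~~ colorable H #|edges T| ->
  exists f : vertex T -> vertex H,
    injective f /\ forall e, e \in edges T -> f @: e \in edges H.
Proof.
move=> unifT treeT unifH ncol; set q := #|edges T| in ncol *.
have [c [properc greedyc]] := greedy_coloring H.
have [z0 z0q] : exists z, q <= c z.
  have [/forallP ltc | /forallPn[z]] := boolP [forall z, c z < q]; last first.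
    by rewrite -leqNgt; exists z.
  case/negP: ncol; apply/existsP; exists [ffun z => Ordinal (ltc z)].
  apply/forall_inP=> e /properc[x [y [xe ye]]].
  apply: contra => /forall_inP/(_ x xe)/forall_inP/(_ y ye).
  by rewrite !ffunE => /eqP[->].
have /card_gt0P[x0 _] := vertex_gt0 T.
pose Q (U : {set vertex T}) (S : {set {set vertex T}}) :=
  [/\ S \subset edges T, forall d, d \in S -> d \subset U &
   exists f : vertex T -> vertex H,
     [/\ {in U &, injective f}, forall d, d \in S -> f @: d \in edges H &
      forall u, u \in U -> q - #|S| <= c (f u)]].
suff [_ _ [f [fI fE _]]] : Q setT (edges T).
  by exists f; split=> // x y; apply: fI; rewrite inE.
apply: (tree_ind (x0 := x0)) treeT _ _.
  split; first exact: sub0set.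
    by move=> d; rewrite inE.
  exists (fun=> z0); split; last by rewrite cards0 subn0.
    by move=> x y /set1P-> /set1P->.
  by move=> d; rewrite inE.
move=> U S e x [ST SU [f [fI fE fc]]] eT eS xe xU ex.
have ST' : e |: S \subset edges T by rewrite subUset sub1set eT.
have cardS : #|e |: S| = #|S|.+1 by rewrite cardsU1 eS.
have ltSq : #|S| < q by rewrite -cardS subset_leq_card.
pose j := q - #|S|.+1.
have defj : q - #|S| = j.+1 by rewrite /j subnSK.
have ltj : j < c (f x) by rewrite -defj fc.
have [e' [e'H fxe' e'c]] := greedyc _ _ ltj.
have [|| g [gE gI]] := @eq_card_bij _ _ (e :\ x) (e' :\ f x).
- have := cardsD1 (f x) e'; have := cardsD1 x e.
  by rewrite xe fxe' unifT // unifH // => -> /addnI.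
- by have := edge_gt1 eT; rewrite (cardsD1 x) xe.
have eU u : u \in e :\ x -> u \notin U.
  by case/setD1P=> /eqP ux ue; apply/negP=> uU; apply/ux/ex.
have gc u : u \in e :\ x -> c (g u) = j.
  move=> ue; have : g u \in e' :\ f x by rewrite -gE imset_f.
  by case/setD1P=> gx ge; apply: e'c.
pose f' u := if u \in e :\ x then g u else f u.
have f'U u : u \in U -> f' u = f u.
  by move=> uU; rewrite /f' ifN //; apply: contraL uU; apply: eU.
split=> //.
  move=> d /setU1P[-> | /SU dU]; first exact: subsetUr.
  by rewrite (subset_trans dU) ?subsetUl.
have f'cases u : u \in U :|: e -> u \in U \/ u \in e :\ x.
  case/setUP=> [uU | ue]; first by left.
  by have [-> | ux] := eqVneq u x; [left | right; rewrite !inE ux].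
have gfF u w : u \in e :\ x -> w \in U -> g u <> f w.
  move=> ue wU eq_gf; have := fc w wU.
  by rewrite -eq_gf gc // defj ltnn.
exists f'; split.
- move=> u w /f'cases[uU | ue] /f'cases[wU | we].
  + by rewrite !f'U //; apply: fI.
  + by rewrite f'U // /f' we => eqfg; case: (gfF _ _ we uU).
  + by rewrite [f' w]f'U // /f' ue => /gfF-/(_ ue wU).
  + by rewrite /f' ue we; apply: gI.
- move=> d /setU1P[-> | dS].
    suff -> : f' @: e = e' by [].
    rewrite -(setD1K xe) imsetU1 f'U // -(setD1K fxe') -gE.
    by congr (_ |: _); apply: eq_in_imset => u ue; rewrite /f' ue.
  rewrite (eq_in_imset (g := f)) ?fE // => u ud.
  by rewrite f'U // (subsetP (SU d dS)).
move=> u; rewrite cardS -/j => /f'cases[uU | ue]; last by rewrite /f' ue gc.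
by rewrite f'U // ltnW // -defj fc.
Qed.

(** * Several colors *)

Definition spanning (H : hypergraph) (F : {set {set vertex H}})
    (sub : F \subset edges H) : hypergraph :=
  Hypergraph (vertex_gt0 H) (fun e eF => edge_gt1 (subsetP sub e eF)).

Lemma colorable_gt0 (H : hypergraph) k : colorable H k -> 0 < k.
Proof.
move=> /existsP[c _]; have /card_gt0P[x _] := vertex_gt0 H.
exact: leq_ltn_trans (ltn_ord (c x)).
Qed.

Lemma chromatic_number_le (H : hypergraph) k :
  colorable H k -> chromatic_number H <= k.
Proof.
rewrite /chromatic_number; case: ex_minnP => m _ minm colk.
by apply: minm; rewrite (colorable_gt0 colk).
Qed.

(** An edge that lies in [P i] is not monochromatic in coordinate [i]. *)
Lemma colorable_product (H : hypergraph) (t q : nat)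
    (P : 'I_t -> {set {set vertex H}}) (sub : forall i, P i \subset edges H) :
  edges H \subset \bigcup_i P i ->
  (forall i, colorable (spanning (sub i)) q) -> colorable H (q ^ t).
Proof.
move=> cov colP; pose c i := xchoose (existsP (colP i)).
have cP i : proper_coloring (c i) by exact: xchooseP.
pose prod x := [ffun i : 'I_t => c i x].
have card_prod : #|{ffun 'I_t -> 'I_q}| = q ^ t.
  by rewrite card_ffun !card_ord.
apply/existsP; exists [ffun x => cast_ord card_prod (enum_rank (prod x))].
apply/forall_inP=> e /(subsetP cov)/bigcupP[i _ ei].
apply: contra (forall_inP (cP i) e ei) => /forall_inP mono.
apply/forall_inP=> x xe; apply/forall_inP=> y ye.
have := forall_inP (mono x xe) y ye.
rewrite !ffunE => /eqP/cast_ord_inj/enum_rank_inj/ffunP/(_ i).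
by rewrite !ffunE => ->.
Qed.

Lemma ramsey_property_tree (r t : nat) (T : hypergraph) :
  uniform r T -> is_tree T -> ramsey_property r T t (#|edges T| ^ t + 1).
Proof.
move=> unifT treeT H unifH chiH P [covP _].
have sub i : P i \subset edges H by rewrite -covP bigcup_sup.
have [/forallP colP | /forallPn[i ncol]] :=
  boolP [forall i, colorable (spanning (sub i)) #|edges T|].
  have cov : edges H \subset \bigcup_i P i by rewrite covP.
  have := chromatic_number_le (colorable_product cov colP).
  by rewrite chiH addn1 ltnn.
have unifPi : uniform r (spanning (sub i)).
  by move=> e ei; apply: unifH; apply: (subsetP (sub i)).
have [f [fI fE]] := tree_embedding unifT treeT unifPi ncol.
exists i, [set f x | x : vertex T], [set f @: e | e : {set vertex T} in edges T].
have FP : [set f @: e | e : {set vertex T} in edges T] \subset P i.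
  by apply/subsetP=> _ /imsetP[e eT ->]; apply: fE.
split=> //; last by exists f.
split; first exact: subset_trans FP (sub i).
move=> _ /imsetP[e _ ->]; apply/subsetP=> _ /imsetP[x _ ->].
exact: imset_f.
Qed.

(** The Ramsey property quantifies over all hypergraphs, so its least witness is
    found by excluded middle. *)
Lemma least_nat (P : nat -> Prop) n :
  P n -> exists m, [/\ P m, m <= n & forall k, P k -> m <= k].
Proof.
elim/ltn_ind: n => n IHn Pn.
have [[k [ltkn Pk]] | nolt] := classic (exists k, k < n /\ P k).
  have [m [Pm lemk minm]] := IHn k ltkn Pk.
  by exists m; split=> //; apply: leq_trans lemk (ltnW ltkn).
exists n; split=> // k Pk; rewrite leqNgt; apply/negP=> ltkn.
by apply: nolt; exists k.
Qed.

Theorem theorem2 (r t : nat) (T : hypergraph) (hr : 2 <= r) (ht : 1 <= t)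
    (unifT : uniform r T) (treeT : is_tree T) :
  exists m : nat,
    is_chromatic_ramsey_number r T t m /\ m <= #|edges T| ^ t + 1.
Proof.
have [| m [[m0 Pm] lem minm]] :=
  @least_nat (fun m => 0 < m /\ ramsey_property r T t m) (#|edges T| ^ t + 1).
  by split; [rewrite addn1 | apply: ramsey_property_tree].
by exists m; split=> //; split=> // n n0 Pn; apply: minm.
Qed.
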